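(* For every graph $G$ with maximum degree $\Delta(G)\le 3$, we have $\chi_\ell^\star(G)\le\chi_c^\star(G)\le 4$.
   Context: A correspondence-cover of a graph $G$ is a pair $(L,H)$ where $H$ is a graph and $L:V(G)\to 2^{V(H)}$ is such that: the sets $L(v)$ partition $V(H)$; for distinct non-adjacent $u,v$ there are no edges of $H$ between $L(u)$ and $L(v)$; for $uv\in E(G)$ the edges of $H$ between $L(u)$ and $L(v)$ form a matching; each $L(v)$ induces a clique in $H$. It is $k$-fold if $|L(v)|=k$ for all $v$. A $k$-list-assignment $L$ assigns each vertex a set $L(v)\subseteq\mathbb{N}$ of size $k$; its list-cover has vertices $x_v$ ($v\in V(G)$, $x\in L(v)$), cliques on each $\{x_v:x\in L(v)\}$, and edges $x_ux_v$ for each $uv\in E(G)$ and $x\in L(u)\cap L(v)$. The list packing number $\chi_\ell^\star(G)$ is the least $k$ such that for every $k$-list-assignment the associated list-cover has chromatic number $k$ (equivalently, there are $k$ pairwise disjoint proper $L$-colourings). The correspondence packing number $\chi_c^\star(G)$ is the least $k$ such that every $k$-fold correspondence-cover $(L,H)$ of $G$ has $\chi(H)=k$. *)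

(* Defs.v *)
From HB Require Import structures.
From mathcomp Require Import all_boot.
From mathcomp Require Import finmap.

Set Implicit Arguments.
Unset Strict Implicit.
Unset Printing Implicit Defensive.

Record sgraph := SGraph {
  vertex :> finType;
  edge : rel vertex;
  edge_sym : symmetric edge;
  edge_irrefl : irreflexive edge }.

Definition max_degree (G : sgraph) : nat := \max_(v : G) #|[set u | edge v u]|.

Definition colorable (G : sgraph) (k : nat) : bool :=
  [exists f : {ffun G -> 'I_k}, [forall u, forall v, edge u v ==> (f u != f v)]].

Lemma colorable_card (G : sgraph) : exists k, colorable G k.
Proof.
exists #|G|; apply/existsP; exists [ffun v => enum_rank v].
apply/forallP=> u; apply/forallP=> v; apply/implyP=> uv; rewrite !ffunE.
by rewrite (inj_eq enum_rank_inj); apply/eqP=> E; rewrite E edge_irrefl in uv.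
Qed.

Definition chromatic_number (G : sgraph) : nat := ex_minn (colorable_card G).

(* The partition is indexed by the vertices of G: distinct vertices have
   disjoint lists. The equality of Booleans in [cover_match] says that two edges
   of H between L u and L v share an end in L u iff they share one in L v. *)
Record correspondence_cover (G H : sgraph) (L : G -> {set H}) : Prop := {
  cover_disj : forall u v : G, u != v -> [disjoint L u & L v];
  cover_all : \bigcup_(v : G) L v = [set: H];
  cover_nonadj : forall u v : G, u != v -> ~~ edge u v ->
    forall x y : H, x \in L u -> y \in L v -> ~~ edge x y;
  cover_match : forall u v : G, edge u v ->
    forall x x' y y' : H, x \in L u -> x' \in L u -> y \in L v -> y' \in L v ->
    edge x y -> edge x' y' -> (x == x') = (y == y');
  cover_clique : forall (v : G) (x y : H),
    x \in L v -> y \in L v -> x != y -> edge x y }.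

Definition fold_cover (k : nat) (G H : sgraph) (L : G -> {set H}) : Prop :=
  correspondence_cover L /\ forall v : G, #|L v| = k.

Definition list_assignment (k : nat) (G : sgraph) (L : G -> {fset nat}) : Prop :=
  forall v : G, #|` L v| = k.

Section ListCover.
Variables (G : sgraph) (L : G -> {fset nat}).

(* The pair (v, x) with x in L v stands for the vertex x_v. *)
Definition list_cover_vertex : finType := {v : G & L v}.

Definition list_cover_edge (a b : list_cover_vertex) : bool :=
  if tag a == tag b then a != b
  else edge (tag a) (tag b) && (val (tagged a) == val (tagged b)).

Lemma list_cover_sym : symmetric list_cover_edge.
Proof.
move=> a b; rewrite /list_cover_edge (eq_sym (tag b)) (eq_sym b).
by rewrite (eq_sym (val (tagged b))) edge_sym.
Qed.

Lemma list_cover_irrefl : irreflexive list_cover_edge.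
Proof. by move=> a; rewrite /list_cover_edge !eqxx. Qed.

Definition list_cover : sgraph := SGraph list_cover_sym list_cover_irrefl.

End ListCover.

Definition is_least (P : nat -> Prop) (k : nat) : Prop :=
  P k /\ forall j, P j -> k <= j.

(* A 0-fold cover has no vertices, hence chromatic number 0, so k = 0 would
   always qualify: it is excluded as soon as G has a vertex. (The graph without
   vertices only has the empty cover, and packing numbers 0.) *)
Definition admissible (G : sgraph) (k : nat) : Prop := 0 < #|G| -> 0 < k.

Definition is_list_packing_number (G : sgraph) : nat -> Prop :=
  is_least (fun k => admissible G k /\
    forall L : G -> {fset nat},
      list_assignment k L -> chromatic_number (list_cover L) = k).

Definition is_correspondence_packing_number (G : sgraph) : nat -> Prop :=
  is_least (fun k => admissible G k /\
    forall (H : sgraph) (L : G -> {set H}),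
      fold_cover k L -> chromatic_number H = k).

(* Main.v *)
(** After identifying each list with {0,1,2,3}, a 4-colouring of a 4-fold cover
    is a permutation c_v in S_4 at each vertex v, and a coloured neighbour of v
    asks c_v to be discordant with (i.e. nowhere equal to) a given permutation.
    Two permutations always have a common discordant one, so vertices with at
    most two coloured neighbours can be coloured greedily; this settles, by
    induction, every vertex set W with a vertex of degree at most 2 in W.
    Otherwise take a path in W starting at x that cannot be prolonged at x. Then
    all three neighbours y, z, w of x lie on it, in this order from x, with y
    next to x. Colour W minus the segment from x to z by induction. Now y has at
    most one coloured neighbour, which leaves enough freedom to colour y in such
    a way that its constraint and that of w at x can be met together with any
    third one. Colour the path from y to z greedily, each vertex before its
    successor and z before x, and finally x. *)

Require Import Defs.
From mathcomp Require Import all_boot.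
From mathcomp Require Import all_fingroup finmap.
From Stdlib Require Import Classical_Prop.

Set Implicit Arguments.
Unset Strict Implicit.
Unset Printing Implicit Defensive.

(** * Discordant permutations *)

Definition disc n (a b : 'S_n) : bool := [forall i, a i != b i].

Lemma disc_mull n (s a b : 'S_n) : disc (s * a)%g (s * b)%g = disc a b.
Proof.
apply/forallP/forallP=> h i; last by rewrite !permM.
by have := h (s^-1 i)%g; rewrite !permM permKV.
Qed.

Lemma disc_mulr n (s a b : 'S_n) : disc (a * s)%g (b * s)%g = disc a b.
Proof. by apply: eq_forallb => i; rewrite !permM (inj_eq perm_inj). Qed.

(** One-line notation: on plain sequences of numbers, a statement about all of S_4 becomes a finite
    check that [vm_compute] can evaluate. *)
Definition disc_seq (s t : seq nat) : bool := all2 (fun a b => a != b) s t.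

Definition seq_perm n (a : 'S_n) : seq nat := [seq val (a i) | i <- enum 'I_n].

Lemma seq_permP n (a : 'S_n) : seq_perm a \in permutations (iota 0 n).
Proof.
rewrite mem_permutations -val_enum_ord /seq_perm (map_comp val a).
apply: perm_map; apply: uniq_perm; rewrite ?enum_uniq //.
  by rewrite (map_inj_uniq perm_inj) enum_uniq.
move=> i; rewrite mem_enum; apply/mapP; exists (a^-1 i)%g; rewrite ?mem_enum //.
by rewrite permKV.
Qed.

Lemma seq_perm_surj n (s : seq nat) :
  s \in permutations (iota 0 n) -> exists a : 'S_n, seq_perm a = s.
Proof.
rewrite mem_permutations => s_perm.
have sz : size s = n by rewrite (perm_size s_perm) size_iota.
have s_lt i : i < n -> nth 0 s i < n.
  move=> lt_in; have: nth 0 s i \in s by rewrite mem_nth ?sz.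
  by rewrite (perm_mem s_perm) mem_iota.
pose f (i : 'I_n) := Ordinal (s_lt i (ltn_ord i)).
have f_inj : injective f.
  move=> i j [] /eqP; rewrite nth_uniq ?sz ?(perm_uniq s_perm) ?iota_uniq //.
  by move=> /eqP/val_inj.
exists (perm f_inj); apply: (@eq_from_nth _ 0).
  by rewrite size_map size_enum_ord sz.
move=> i; rewrite size_map size_enum_ord => lt_in.
by rewrite (nth_map (Ordinal lt_in)) ?size_enum_ord // permE /= nth_enum_ord.
Qed.

Lemma disc_seq_perm n (a b : 'S_n) :
  disc_seq (seq_perm a) (seq_perm b) = disc a b.
Proof.
rewrite /disc_seq /seq_perm all2E !size_map eqxx /= zip_map all_map.
apply/allP/forallP => h i; last by rewrite /= (inj_eq val_inj).
by have := h i; rewrite mem_enum /= (inj_eq val_inj); apply.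
Qed.

(* The case q = 1 of [disc4]. [S] is kept abstract so that using the lemma does
   not unfold the enumeration. *)
Lemma disc4_seq (S : seq (seq nat)) : S = permutations (iota 0 4) ->
  all (fun p => has (fun g => disc_seq g p && all (fun e => has (fun c =>
    [&& disc_seq c (iota 0 4), disc_seq c g & disc_seq c e]) S) S) S) S.
Proof. by move=> ->; vm_compute. Qed.

(* A suitable g is one such that g q^-1 is an involution or the identity. *)
Lemma disc4 (p q : 'S_4) : exists2 g : 'S_4, disc g p &
  forall e : 'S_4, exists c : 'S_4, [/\ disc c q, disc c g & disc c e].
Proof.
have [S S_perms] : {S : seq (seq nat) | S = permutations (iota 0 4)}.
  by exists (permutations (iota 0 4)).
have inS (a : 'S_4) : seq_perm a \in S by rewrite S_perms seq_permP.
have onS s : s \in S -> exists a : 'S_4, seq_perm a = s.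
  by rewrite S_perms; apply: seq_perm_surj.
have seq_perm1 : iota 0 4 = seq_perm (1%g : 'S_4).
  by rewrite -val_enum_ord; apply: eq_map => i; rewrite perm1.
(* Right multiplication by q^-1 preserves discordance and turns q into the identity. *)
have /allP/(_ _ (inS (p * q^-1)%g))/hasP[g'] := disc4_seq S_perms.
case/onS=> g <-; rewrite disc_seq_perm seq_perm1 => /andP[gp /allP h].
exists (g * q)%g; first by rewrite -(disc_mulr q^-1) mulgK.
move=> e; have /hasP[c'] := h _ (inS (e * q^-1)%g).
case/onS=> c <-; rewrite !disc_seq_perm => /and3P[c1 cg ce].
exists (c * q)%g; split; rewrite -(disc_mulr q^-1) ?mulgV mulgK //.
by rewrite mulgK.
Qed.

(** * Completing a matching to a permutation *)

Lemma partial_inj_perm (T : finType) (F : rel T) :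
  (forall i i' j j', F i j -> F i' j' -> (i == i') = (j == j')) ->
  exists s : {perm T}, forall i j, F i j -> s i = j.
Proof.
move=> F_inj.
pose A := [set i | [exists j, F i j]].
pose f i := odflt i [pick j | F i j].
have fP i j : F i j -> f i = j.
  rewrite /f; case: pickP => [j' Fj' Fj|-> //] /=.
  by apply/eqP; rewrite -(F_inj _ _ _ _ Fj' Fj).
have f_inj : {in A &, injective f}.
  move=> i i'; rewrite !inE => /existsP[j Fij] /existsP[j' Fij'].
  rewrite (fP _ _ Fij) (fP _ _ Fij') => /eqP.
  by rewrite -(F_inj _ _ _ _ Fij Fij') => /eqP.
(* As f is injective on A, the complements of A and of its image have the same size; g matches them
   in the order of enumeration, so the default of [nth] is never reached. *)
have eqc : #|~: A| = #|~: (f @: A)|.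
  by rewrite cardsCs setCK [RHS]cardsCs setCK card_in_imset.
pose g i := if i \in A then f i else
  nth i (enum (~: (f @: A))) (index i (enum (~: A))).
have gC i : i \notin A -> g i \notin f @: A.
  move=> iA; rewrite /g (negPf iA) -in_setC -mem_enum mem_nth //.
  by rewrite -cardE -eqc cardE index_mem mem_enum in_setC.
have gA i : i \in A -> g i \in f @: A by move=> iA; rewrite /g iA imset_f.
have g_inj : injective g.
  move=> i j; case: (boolP (i \in A)) (boolP (j \in A)) => iA [] jA eg.
  - by move: eg; rewrite /g iA jA; apply: f_inj.
  - by have := gC _ jA; rewrite -eg gA.
  - by have := gC _ iA; rewrite eg gA.
  have lt k : k \notin A -> index k (enum (~: A)) < size (enum (~: (f @: A))).
    by move=> kA; rewrite -cardE -eqc cardE index_mem mem_enum in_setC.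
  move: eg; rewrite /g (negPf iA) (negPf jA) (set_nth_default j) ?lt // => /eqP.
  rewrite nth_uniq ?lt ?enum_uniq // => /eqP.
  by apply: (index_inj i); rewrite mem_enum in_setC.
exists (perm g_inj) => i j Fij; rewrite permE /g.
by rewrite inE; case: existsP => [_|[]]; [apply: fP | exists j].
Qed.

(** * Packings in graphs of maximum degree at most 3 *)

Section Packing.
(** The cover enters only through [ok], the compatibility of permutations chosen at two vertices.
    The s of [ok_disc] stands for the matching of an edge, completed to a permutation. *)
Variables (G : sgraph) (ok : G -> G -> 'S_4 -> 'S_4 -> bool).
Hypothesis G_deg : forall v : G, #|[set u | edge v u]| <= 3.
Hypothesis ok_sym : forall u v a b, ok u v a b = ok v u b a.
Hypothesis ok_disc : forall u v, edge u v ->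
  exists s : 'S_4, forall a b, disc b (s * a)%g -> ok u v a b.

Definition packed (W : {set G}) (c : G -> 'S_4) :=
  forall u v, u \in W -> v \in W -> edge u v -> ok u v (c u) (c v).

Definition nbrs (W : {set G}) (v : G) := [set u in W | edge u v].

Lemma nbrs_constraints (W : {set G}) c v :
  exists2 ps : seq 'S_4, size ps = #|nbrs W v| &
    forall d, all (disc d) ps -> forall u, u \in nbrs W v -> ok u v (c u) d.
Proof.
have: forall u, u \in enum (nbrs W v) -> edge u v.
  by move=> u; rewrite mem_enum inE => /andP[].
rewrite cardE.
(* Only this inclusion and adjacency are kept, so that the induction can pass to the tail of the
   enumeration. *)
have: forall u, u \in nbrs W v -> u \in enum (nbrs W v).
  by move=> u; rewrite mem_enum.
move: (enum (nbrs W v)) => s; elim: s (nbrs W v) => [|w s IHs] A sub adj.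
  by exists [::] => // d _ u /sub.
have [||ps sz psP] := IHs [set u in s].
- by move=> u; rewrite inE.
- by move=> u us; rewrite adj // inE us orbT.
have [|t tP] := @ok_disc w v; first by rewrite adj // inE eqxx.
exists ((t * c w)%g :: ps) => [|d /= /andP[dw dps] u /sub].
  by rewrite /= sz.
rewrite inE => /predU1P[->|us]; first exact: tP.
by apply: psP => //; rewrite inE.
Qed.

Definition upd (c : G -> 'S_4) v d := fun u => if u == v then d else c u.

Lemma packed_upd (W : {set G}) c v d : packed W c -> v \notin W ->
  (forall u, u \in nbrs W v -> ok u v (c u) d) -> packed (v |: W) (upd c v d).
Proof.
move=> cW vW dv; have nv u : u \in W -> (u == v) = false.
  by move=> uW; apply: contraNF vW => /eqP <-.
move=> a b /setU1P[->|aW] /setU1P[->|bW] ab; rewrite /upd ?eqxx ?nv //.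
- by rewrite edge_irrefl in ab.
- by rewrite ok_sym dv // inE bW edge_sym.
- by rewrite dv // inE aW.
exact: cW.
Qed.

Lemma packed_extend (W : {set G}) c v : packed W c -> v \notin W ->
  #|nbrs W v| <= 2 ->
  exists2 c', packed (v |: W) c' & {in W, c' =1 c}.
Proof.
move=> cW vW; have [ps <- psP] := nbrs_constraints W c v => sz.
have [d dP] : exists d, all (disc d) ps.
  case: ps sz {psP} => [|p [|q []]] // _; first by exists 1%g.
    by have [g gp _] := disc4 p p; exists g; rewrite /= gp.
  (* Two constraints p and q: take p for both arguments of [disc4] and q as the third
     permutation. *)
  have [g _ /(_ q) [c0 [cp _ cq]]] := disc4 p p.
  by exists c0; rewrite /= cp cq.
exists (upd c v d); first by apply: packed_upd => //; apply: psP.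
by move=> u uW; rewrite /upd; case: eqP => // uv; rewrite -uv uW in vW.
Qed.

(** Neighbours of v known to lie outside W use up part of its degree, which is at most 3. *)
Lemma nbrs_miss (W : {set G}) v (s : seq G) :
  uniq s -> {in s, forall u, edge v u && (u \notin W)} ->
  #|nbrs W v| + size s <= 3.
Proof.
move=> s_uniq sP; apply: leq_trans (G_deg v).
have <- : #|[set u in s]| = size s by rewrite cardsE; apply/card_uniqP.
rewrite -cardsUI; have -> : nbrs W v :&: [set u in s] = set0.
  apply/setP=> u; rewrite !inE; apply/negP => /andP[/andP[uW _] /sP].
  by rewrite uW andbF.
rewrite cards0 addn0; apply/subset_leq_card/subsetP=> u; rewrite !inE edge_sym.
by case/orP=> [/andP[] //|/sP/andP[]].
Qed.

(** Greedy colouring along the path, leaving out its last vertex: each vertex still has an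
    uncoloured successor, hence at most two coloured neighbours. *)
Lemma packed_path (W : {set G}) c (x : G) p :
  packed W c -> path (@edge G) x p -> uniq (x :: p) ->
  {in x :: p, forall u, u \notin W} ->
  exists2 c', packed (W :|: [set u in belast x p]) c' & {in W, c' =1 c}.
Proof.
elim: p x W c => [|y p IHp] x W c cW /=.
  by exists c => // u v; rewrite !inE !orbF; apply: cW.
move=> /andP[xy yp] /and3P[xNyp yNp p_uniq] nW.
have [|||c1 c1W c1c] := @packed_extend W c x => //.
- by rewrite nW ?inE ?eqxx.
- have := @nbrs_miss W x [:: y] isT; rewrite /= addn1 ltnS; apply.
  by move=> u; rewrite inE => /eqP->; rewrite xy nW // !inE eqxx orbT.
have [|||c2 c2W c2c] := IHp y _ c1 c1W => //; first by rewrite /= yNp.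
  move=> u u_yp; rewrite !inE negb_or nW ?andbT 1?inE ?u_yp ?orbT //.
  by apply: contraNneq xNyp => <-.
exists c2; last by move=> u uW; rewrite c2c ?c1c // !inE uW orbT.
suff <- : x |: W :|: [set u in belast y p] =
  W :|: [set u in x :: belast y p] by [].
by apply/setP=> u; rewrite !inE; case: (u == x); case: (u \in W).
Qed.

(** Take a longest path in W: a neighbour of x in W off the path could be put in front of x. *)
Lemma maximal_path (W : {set G}) v : v \in W ->
  exists x p, [/\ path (@edge G) x p, uniq (x :: p), {subset x :: p <= W} &
    {in nbrs W x, forall u, u \in p}].
Proof.
move=> vW.
pose P n := [exists t : n.-tuple G,
  [&& sorted (@edge G) t, uniq t & all (mem W) t]].
have P1 : exists n, P n.
  by exists 1; apply/existsP; exists [tuple v]; rewrite /= vW.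
have Pub n : P n -> n <= #|G|.
  case/existsP=> t /and3P[_ t_uniq _]; rewrite -(size_tuple t).
  by rewrite -(card_uniqP t_uniq) max_card.
case: (ex_maxnP P1 Pub) => n /existsP[t /and3P[t_path t_uniq tW]] n_max.
have n_gt0 : 0 < n.
  by apply: n_max; apply/existsP; exists [tuple v]; rewrite /= vW.
case: t t_path t_uniq tW => [[|x p] /= sz]; first by rewrite -(eqP sz) in n_gt0.
move=> xp x_uniq xpW; exists x, p; split=> // [u|u].
  by move=> u_xp; apply: (allP (xpW : all (mem W) (x :: p))).
rewrite inE => /andP[uW ux]; apply: contraFT (ltnn n) => uNp.
apply: n_max; apply/existsP.
have sz' : size (u :: x :: p) == n.+1 by rewrite /= eqSS.
exists (Tuple sz'); rewrite /= ux xp uW xpW inE negb_or uNp x_uniq !andbT.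
by apply: contraTneq ux => ->; rewrite edge_irrefl.
Qed.

Lemma packed_exists (W : {set G}) : exists c, packed W c.
Proof.
have [n] := ubnP #|W|; elim: n W => // n IHn W; rewrite ltnS => leWn.
case: (set_0Vmem W) => [->|[v0 v0W]].
  by exists (fun=> 1%g) => u v; rewrite inE.
have [/existsP[v /andP[vW dv]]|] :=
  boolP [exists v, (v \in W) && (#|nbrs W v| <= 2)].
  have [|c cW] := IHn (W :\ v).
    by rewrite (leq_trans _ leWn) // [in X in _ < X](cardsD1 v) vW.
  have [||c' c'W _] := @packed_extend (W :\ v) c v cW; rewrite ?setD11 //.
    apply: leq_trans dv; apply/subset_leq_card/subsetP=> u.
    by rewrite !inE => /andP[/andP[_ ->]].
  by rewrite setD1K // in c'W; exists c'.
rewrite negb_exists => /forallP deg3.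
have {}deg3 v : v \in W -> 2 < #|nbrs W v|.
  by move=> vW; have := deg3 v; rewrite vW /= -ltnNge.
have [x [p [xp x_uniq xpW xmax]]] := maximal_path v0W.
have xW : x \in W by rewrite xpW // inE eqxx.
case: p => [|y p] in xp x_uniq xpW xmax *.
  have := deg3 _ xW; case: (set_0Vmem (nbrs W x)) => [->|[u /xmax //]].
  by rewrite cards0.
have other (A : seq G) : size A <= 2 -> exists2 u, u \in nbrs W x & u \notin A.
  move=> szA; apply/subsetPn; apply: contraL (deg3 _ xW) => /subset_leq_card.
  by rewrite -leqNgt => /leq_trans; apply; apply: leq_trans (card_size A) szA.
have x_has : has (@edge G x) p.
  have [u ux] := other [:: y] isT; rewrite inE => uy.
  apply/hasP; exists u; last by move: ux; rewrite inE edge_sym => /andP[].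
  by have := xmax _ ux; rewrite inE (negPf uy).
(* Here z is the first neighbour of x after y, so s contains none, and the third neighbour w must
   lie in r. *)
case: (split_find x_has) xp x_uniq xpW xmax => z s r xz sNx.
move=> {p x_has} /= /andP[xy ysr] x_uniq xpW xmax.
have [w wx wNyz] := other [:: y; z] isT.
have [wW xw] : w \in W /\ edge w x by move: wx; rewrite inE => /andP.
move: wNyz; rewrite !inE negb_or => /andP[wNy wNz].
have w_r : w \in r.
  have := xmax _ wx.
  rewrite inE (negPf wNy) mem_cat mem_rcons inE (negPf wNz) /=.
  by case/orP=> // ws; case/hasP: sNx; exists w; rewrite // edge_sym.
(* The successor a of y on the path is z itself when s is empty. *)
have [a [t s_z]] : exists a t, rcons s z = a :: t.
  by case: (s) => [|a s']; [exists z, [::] | exists a, (rcons s' z)].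
have zs : z \in rcons s z by rewrite mem_rcons inE eqxx.
move: ysr; rewrite cat_path => /andP[ys _].
(* With x appended, z is no longer last, so [packed_path] colours it and stops before x. *)
have az : path (@edge G) a (rcons t x).
  suff: path (@edge G) y (rcons (rcons s z) x) by rewrite s_z /= => /andP[].
  by rewrite rcons_path ys last_rcons edge_sym.
move: x_uniq; rewrite inE !mem_cat !negb_or cat_uniq.
case/and3P=> /and3P[xNy xNs xNr] /andP[yNs yNr] /and3P[s_uniq rNs _].
pose W' := W :\: [set u in x :: y :: rcons s z].
have inW' u : (u \in W') = [&& u != x, u != y, u \notin rcons s z & u \in W].
  by rewrite !inE !negb_or -!andbA.
have wW' : w \in W'.
  rewrite inW' wW wNy andbT; apply/and3P; split => //.
    by apply: contraNneq xNr => <-.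
  by apply: contraNN rNs => ws; apply/hasP; exists w.
have [|c0 c0W] := IHn W'.
  rewrite (leq_trans _ leWn) // proper_card // properE subsetDl /=.
  by apply/subsetPn; exists x; rewrite // inW' eqxx.
have [ps szps psP] := nbrs_constraints W' c0 y.
(* Both x and a are neighbours of y outside [W']. *)
have {}szps : size ps <= 1.
  rewrite szps; have := @nbrs_miss W' y [:: x; a]; rewrite /= addn2 !ltnS; apply.
    by rewrite inE andbT; apply: contraNneq xNs => ->; rewrite s_z inE eqxx.
  move=> u; rewrite !inE => /orP[]/eqP->; first by rewrite eqxx edge_sym xy.
  by move: ys; rewrite s_z inE eqxx !orbT /= andbT => /andP[].
(* A missing constraint at y is replaced by the identity. *)
have [p pP] : exists p, forall d, disc d p -> all (disc d) ps.
  case: ps szps {psP} => [|p []] // _; first by exists 1%g.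
  by exists p => d /= ->.
have [tw twP] := ok_disc xw.
have [ty tyP] : exists ty : 'S_4, forall a b, disc b (ty * a)%g -> ok y x a b.
  by apply: ok_disc; rewrite edge_sym.
have [tz tzP] : exists tz : 'S_4, forall a b, disc b (tz * a)%g -> ok z x a b.
  by apply: ok_disc; rewrite edge_sym.
(* This g is what y will impose on x, so y receives ty^-1 g; [gp] then says that this colour
   respects p. The second argument is what w imposes on x. *)
have [g gp gP] := disc4 (ty * p)%g (tw * c0 w)%g.
have c1W : packed (y |: W') (upd c0 y (ty^-1 * g)%g).
  apply: packed_upd => //; first by rewrite inW' eqxx andbF.
  by apply/psP/pP; rewrite -(disc_mull ty) mulKVg.
have [||c2] := packed_path c1W az.
- by rewrite -rcons_cons -s_z rcons_uniq xNs.
- move=> u; rewrite -rcons_cons -s_z mem_rcons in_setU1 inW' inE negb_or.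
  case/predU1P=> [->|us]; first by rewrite xNy eqxx.
  by rewrite us !andbF andbT; apply: contraNneq yNs => <-.
rewrite belast_rcons -s_z => c2W c2E.
have {}c2W : packed (W :\ x) c2.
  move=> u v; rewrite !in_setD1 => /andP[ux uW] /andP[vx vW] uv.
  have inW u' : u' != x -> u' \in W -> u' \in y |: W' :|: [set u in rcons s z].
    rewrite in_setU in_setU1 inW' in_set => -> ->; rewrite andbT /=.
    by case: (u' == y); case: (u' \in rcons _ _).
  by apply: c2W => //; apply: inW.
(* The colour of z is known only after g has been fixed, whence the quantifier over e in [disc4]. *)
have [d [dw dy dz]] := gP (tz * c2 z)%g.
exists (upd c2 x d); rewrite -(setD1K xW); apply: packed_upd => //.
  by rewrite setD11.
move=> u ux.
(* The three neighbours y, z, w exhaust the degree of x. *)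
have : u \in [:: y; z; w].
  have := @nbrs_miss (W :\: [set u in [:: y; z; w]]) x [:: y; z; w].
  rewrite /= addn3 !ltnS !inE (eq_sym y w) (eq_sym z w) negb_or wNy wNz !andbT.
  rewrite leqn0 cards_eq0 => H; apply: contraLR isT => uN /=.
  have /eqP/setP/(_ u) : nbrs (W :\: [set u in [:: y; z; w]]) x == set0.
    apply: H; first by apply: contraNneq yNs => ->.
    move=> v; rewrite !inE => vyzw; rewrite vyzw andbT.
    by case/or3P: vyzw => /eqP-> //; rewrite edge_sym.
  by move: ux uN; rewrite !inE => /andP[/andP[_ ->] ->] ->.
rewrite !inE => /or3P[]/eqP->.
- by apply: tyP; rewrite c2E ?setU11 // /upd eqxx mulKVg.
- exact: tzP.
- by apply: twP; rewrite c2E ?in_setU1 ?wW' ?orbT // /upd (negPf wNy).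
Qed.

End Packing.

(** * From packings to colourings of covers *)

Section Covers.
Variables (G H : sgraph) (L : G -> {set H}).

Lemma fold_cover_colorable4 : max_degree G <= 3 -> fold_cover 4 L ->
  colorable H 4.
Proof.
move=> G_deg [L_cover L_card].
have Gv_deg (v : G) : #|[set u | edge v u]| <= 3.
  by apply: leq_trans G_deg; apply: leq_bigmax.
pose e v (i : 'I_4) : H := enum_val (cast_ord (esym (L_card v)) i).
have e_in v i : e v i \in L v by apply: enum_valP.
have e_inj v : injective (e v) by move=> i j /enum_val_inj/cast_ord_inj.
have e_owner u v i j : e u i = e v j -> u = v.
  move=> eq_e; apply: contraTeq (e_in u i) => uv.
  by rewrite eq_e (disjointFl (cover_disj L_cover uv)).
have e_surj x : exists vi, e vi.1 vi.2 == x.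
  have := in_setT x; rewrite -(cover_all L_cover) => /bigcupP[v _ xv].
  exists (v, cast_ord (L_card v) (enum_rank_in xv x)).
  by rewrite /e /= cast_ordK enum_rankK_in.
pose ok u v (a b : 'S_4) :=
  [forall i, forall j, edge (e u i) (e v j) ==> (a i != b j)].
have okP u v (a b : 'S_4) :
  reflect (forall i j, edge (e u i) (e v j) -> a i != b j) (ok u v a b).
  by apply: (iffP 'forall_forallP) => h i j; apply/implyP; apply: h.
have ok_sym u v a b : ok u v a b = ok v u b a.
  by apply/okP/okP=> h i j; rewrite edge_sym eq_sym; apply: h.
have ok_disc u v : edge u v ->
  exists s : 'S_4, forall a b, disc b (s * a)%g -> ok u v a b.
  (* The relation goes from indices at v to indices at u because s acts first in s * a. Completing
     the matching only adds constraints. *)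
  move=> uv; pose F := [rel j i | edge (e u i) (e v j)].
  have [|s sP] := @partial_inj_perm _ F.
    move=> j j' i i' /= ij ij'.
    rewrite -(inj_eq (@e_inj u) i) -(inj_eq (@e_inj v) j).
    by apply/esym; apply: (cover_match L_cover uv) ij ij'.
  exists s => a b /forallP ba; apply/okP=> i j ij.
  by have := ba j; rewrite permM (sP j i) // eq_sym.
have [c cP] := packed_exists Gv_deg ok_sym ok_disc setT.
apply/existsP; exists [ffun x => let vi := xchoose (e_surj x) in c vi.1 vi.2].
have unique x v i : e v i = x -> xchoose (e_surj x) = (v, i).
  move=> eq_x; have /eqP := xchooseP (e_surj x); case: (xchoose _) => u j /=.
  rewrite -eq_x => eq_e; have uv := e_owner _ _ _ _ eq_e.
  by move: eq_e; rewrite uv => /e_inj->.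
apply/'forall_forallP=> x y; apply/implyP; rewrite !ffunE /=.
have [[u i] /eqP/= ux] := e_surj x; have [[v j] /eqP/= vy] := e_surj y.
rewrite (unique x u i) // (unique y v j) //= => xy; move: xy; rewrite -ux -vy.
case: (eqVneq u v) => [<-|uv].
  by rewrite (inj_eq perm_inj); apply: contraTneq => ->; rewrite edge_irrefl.
case: (boolP (edge u v)) => [adj|nadj xy].
  by move/okP: (cP u v (in_setT _) (in_setT _) adj); apply.
by have := cover_nonadj L_cover uv nadj (e_in u i) (e_in v j); rewrite xy.
Qed.

(** The clique on [L v] alone needs k colours. *)
Lemma fold_cover_le_colorable k j (v : G) : fold_cover k L -> colorable H j ->
  k <= j.
Proof.
move=> [L_cover L_card] /existsP[f /'forall_forallP fP].
rewrite -(L_card v) -(card_in_imset (f := f)); last first.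
  move=> x y xv yv; apply: contra_eq => xy.
  exact: implyP (fP x y) (cover_clique L_cover xv yv xy).
by rewrite -[j in _ <= j]card_ord max_card.
Qed.

End Covers.

(** * Packing numbers *)

Lemma chromatic_numberP (H : sgraph) k :
  colorable H k -> (forall j, colorable H j -> k <= j) ->
  chromatic_number H = k.
Proof.
move=> Hk k_min; rewrite /chromatic_number; case: ex_minnP => j Hj j_min.
by apply/eqP; rewrite eqn_leq j_min // k_min.
Qed.

Lemma fold_cover_empty_chromatic k (G H : sgraph) (L : G -> {set H}) :
  #|G| = 0 -> fold_cover k L -> chromatic_number H = 0.
Proof.
move=> G0 [L_cover _].
have H0 (x : H) : False.
  have := in_setT x; rewrite -(cover_all L_cover) => /bigcupP[v].
  by have := card0_eq G0 v.
apply: chromatic_numberP => //; apply/existsP.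
have H_card : #|H| = 0 by apply: eq_card0 => x; case: (H0 x).
exists (ffun0 H_card); apply/forallP=> x; by case: (H0 x).
Qed.

(** This yields the inequality between the two packing numbers: what holds for all covers holds for
    list covers. *)
Lemma list_cover_fold k (G : sgraph) (L : G -> {fset nat}) :
  list_assignment k L ->
  fold_cover k (fun v => [set a : list_cover L | tag a == v]).
Proof.
move=> L_card; split; last first.
  move=> v; rewrite -(L_card v) cardfE -cardsT.
  rewrite -(card_imset _ (@eq_from_Tagged _ (fun u => L u) v)).
  apply: eq_card => -[u x]; rewrite inE /=; apply/eqP/imsetP=> [uv|[y _ e]].
    by subst u; exists x.
  exact: (congr1 tag e).
split.
- move=> u v uv; rewrite disjoints_subset; apply/subsetP=> a.
  by rewrite !inE => /eqP->.
- apply/setP=> a; rewrite inE; apply/bigcupP; exists (tag a) => //.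
  by rewrite inE.
- move=> u v uv nuv [u1 x] [v1 y]; rewrite !inE /= => /eqP eu /eqP ev.
  subst u1 v1; rewrite /edge /= /list_cover_edge /=.
  by rewrite (negPf uv) (negPf nuv).
- move=> u v uv [u1 x] [u2 x'] [v1 y] [v2 y']; rewrite !inE /=.
  move=> /eqP eu1 /eqP eu2 /eqP ev1 /eqP ev2; subst u1 u2 v1 v2.
  have uNv : (u == v) = false.
    by apply: contraTF uv => /eqP->; rewrite edge_irrefl.
  rewrite /edge /= /list_cover_edge /= uNv.
  move=> /andP[_ /eqP xy] /andP[_ /eqP xy'].
  rewrite !eq_Tagged /= -(inj_eq val_inj x) -(inj_eq val_inj y) /=.
  by rewrite xy xy'.
- move=> v [u1 x] [u2 y]; rewrite !inE /= => /eqP eu1 /eqP eu2 xy.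
  by subst u1 u2; rewrite /edge /= /list_cover_edge /= eqxx.
Qed.

(** The properties to be minimised quantify over all covers or lists, so excluded middle decides
    whether a smaller witness exists. *)
Lemma ex_least (P : nat -> Prop) n : P n -> exists2 k, is_least P k & k <= n.
Proof.
elim/ltn_ind: n => n IHn Pn.
case: (classic (exists2 m, m < n & P m)) => [[m lt_mn Pm]|min_n].
  have [k kP le_km] := IHn m lt_mn Pm.
  by exists k => //; apply: leq_trans le_km (ltnW lt_mn).
exists n => //; split=> // j Pj; rewrite leqNgt; apply/negP=> lt_jn.
by apply: min_n; exists j.
Qed.

Theorem theorem15 (G : sgraph) (hG : max_degree G <= 3) :
  exists kl kc : nat,
    [/\ is_list_packing_number G kl,
        is_correspondence_packing_number G kc &
        kl <= kc <= 4].
Proof.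
pose corr k := admissible G k /\ forall (H : sgraph) (L : G -> {set H}),
  fold_cover k L -> chromatic_number H = k.
pose list k := admissible G k /\ forall L : G -> {fset nat},
  list_assignment k L -> chromatic_number (list_cover L) = k.
have [k le_k4 k_corr] : exists2 k, k <= 4 & corr k.
  (* Without vertices every cover has chromatic number 0; otherwise the list of any vertex forces 4
     colours. *)
  case: (posnP #|G|) => [G0|G_gt0].
    exists 0 => //; split=> [|H L]; first by rewrite /admissible G0.
    exact: fold_cover_empty_chromatic.
  exists 4 => //; split=> // H L H_cover; apply: chromatic_numberP.
    exact: fold_cover_colorable4 hG H_cover.
  have [v _] := card_gt0P G_gt0.
  by move=> j; apply: fold_cover_le_colorable v H_cover.
have [kc kc_least le_kc] := ex_least k_corr.
have [kc_adm kcP] := kc_least.1.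
have kc_list : list kc by split=> // L /list_cover_fold; apply: kcP.
have [kl kl_least le_kl] := ex_least kc_list.
by exists kl, kc; split; rewrite // le_kl (leq_trans le_kc).
Qed.
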